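(* Let $\Omega\subset\mathbb{R}^n$ be a bounded domain, $\varepsilon>0$, and $\alpha,\beta>0$ with $\alpha+\beta=1$. Suppose that $u$ and $u'$ are two $p$-harmonious functions on $\Omega_\varepsilon$ with boundary values $g$ and $g'$ (respectively) on $\Gamma_\varepsilon$. Then $$\sup_{x\in\Omega}|u'-u|(x)\le\sup_{x\in\Gamma_\varepsilon}|g'-g|(x).$$
   Context: $B_\varepsilon(x)$ denotes the open ball of radius $\varepsilon$ centred at $x$, and $|B_\varepsilon(x)|$ its Lebesgue measure. The $\varepsilon$-boundary strip is $\Gamma_\varepsilon=\{x\in\mathbb{R}^n\setminus\Omega:\operatorname{dist}(x,\Omega)\le\varepsilon\}$, and $\Omega_\varepsilon=\Gamma_\varepsilon\cup\Omega$. A $p$-harmonious function with boundary values $g$, where $g:\Gamma_\varepsilon\to\mathbb{R}$ is a bounded Borel function, is a bounded Borel function $u:\Omega_\varepsilon\to\mathbb{R}$ with $u=g$ on $\Gamma_\varepsilon$ that satisfies the dynamic programming principle $$u(x)=\frac{\alpha}{2}\sup_{B_\varepsilon(x)}u+\frac{\alpha}{2}\inf_{B_\varepsilon(x)}u+\frac{\beta}{|B_\varepsilon(x)|}\int_{B_\varepsilon(x)}u\,dy\qquad\text{for every }x\in\Omega.$$ *)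

(* Defs.v *)
From HB Require Import structures.
From mathcomp Require Import all_boot all_order all_algebra.
From mathcomp Require Import all_classical all_reals all_analysis measurable_realfun.

Set Implicit Arguments.
Unset Strict Implicit.
Unset Printing Implicit Defensive.
Import Order.TTheory GRing.Theory Num.Theory.
Import numFieldNormedType.Exports.

Local Open Scope classical_set_scope.
Local Open Scope ring_scope.

Section borel_matrix.
Context (R : realType) (m n : nat).

Let borel : set (set 'M[R]_(m, n)) := <<s @open 'M[R]_(m, n) >>.

HB.instance Definition _ :=
  @isMeasurable.Build (sigma_display (@open 'M[R]_(m, n))) 'M[R]_(m, n) borel
    (@sigma_algebra0 _ setT _) (@sigma_algebraC 'M[R]_(m, n) open)
    (@sigma_algebra_bigcup _ setT _).

End borel_matrix.

Section borel_rV.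
Context (R : realType).

Lemma open_measurable_rV n (A : set 'rV[R]_n) : open A -> measurable A.
Proof. exact: sub_sigma_algebra. Qed.

Lemma measurable_fun_coord n (i : 'I_n) :
  measurable_fun [set: 'rV[R]_n] (fun v : 'rV[R]_n => v 0 i).
Proof.
apply: (measurability _ (RGenOInfty.measurableE R)).
move=> _ [_ [a ->] <-]; rewrite setTI; apply: open_measurable_rV.
by apply: open_comp; [move=> v _; exact: coord_continuous|exact: interval_open].
Qed.

Lemma measurable_rV d (T : measurableType d) n (f : T -> 'rV[R]_n) :
  (forall i, measurable_fun setT (fun t => f t 0 i)) -> measurable_fun setT f.
Proof.
move=> mf.
apply: (@measurability _ _ _ _ setT f (@open 'rV[R]_n)) => // _ [A oA <-].
rewrite setTI.
pose B (p : 'rV[rat]_n * nat) : set 'rV[R]_n :=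
  ball (map_mx ratr p.1 : 'rV[R]_n) (p.2.+1%:R^-1).
have -> : A = \bigcup_(p in [set p | B p `<=` A]) B p.
  apply/seteqP; split=> [x Ax|x [p /= +]]; last exact.
  have /nbhs_ballP[e /= e0 xeA] : nbhs x A by exact: open_nbhs_nbhs.
  have [k ke] : exists k : nat, k.+1%:R^-1 < e / 2.
    have [k _ kP] := near_infty_natSinv_lt (PosNum (divr_gt0 e0 (ltr0Sn R 1))).
    by exists k; exact: (kP k (leqnn k)).
  have q_ i : exists q : rat, ball (x 0 i) k.+1%:R^-1 (ratr q : R).
    have [|r [xr [q _ qr]]] := @dense_rat R (ball (x 0 i) k.+1%:R^-1) _ (ball_open _ _).
      by exists (x 0 i); apply: ballxx; rewrite invr_gt0.
    by exists q; rewrite qr.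
  pose q := \row_i sval (cid (q_ i)).
  have qx : B (q, k) x.
    split=> /=; first by rewrite invr_gt0.
    move=> i j; rewrite (ord1 i) !mxE; apply: ball_sym.
    exact: (svalP (cid (q_ j))).
  exists (q, k) => //= y qy; apply: xeA; apply: (@le_ball _ _ _ (k.+1%:R^-1 + k.+1%:R^-1)).
    by rewrite (splitr e) lerD// ltW.
  by apply: ball_triangle qy; apply: ball_sym.
rewrite preimage_bigcup bigcup_mkcond.
apply: countable_bigcupT_measurable => [|[q k]]; first exact: countableP.
case: ifPn => // _.
rewrite (_ : f @^-1` B (q, k) =
    \bigcap_(i in [set: 'I_n]) ((fun t => f t 0 i) @^-1` ball (ratr (q 0 i) : R) k.+1%:R^-1)).
  apply: fin_bigcap_measurable => // i _.
  rewrite -[X in measurable X]setTI; apply: mf => //.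
  by apply: open_measurable; exact: ball_open.
apply/seteqP; split=> t /=.
  by move=> [_ h] i _; have := h 0 i; rewrite mxE.
move=> h; split=> [|i j]; first by rewrite invr_gt0.
by rewrite (ord1 i) mxE; exact: h.
Qed.

End borel_rV.

Section lebesgue_rV_step.
Context (R : realType) (n : nat).

Definition rV_cons (p : measurableTypeR R * 'rV[R]_n) : 'rV[R]_n.+1 :=
  row_mx (p.1 : R)%:M p.2.

Definition rV_uncons (v : 'rV[R]_n.+1) : measurableTypeR R * 'rV[R]_n :=
  (v 0 0, \row_i v 0 (lift ord0 i)).

Lemma rV_consE0 p : rV_cons p 0 0 = p.1.
Proof.
rewrite (_ : 0 = @lshift 1 n 0 :> 'I_n.+1); last exact/val_inj.
by apply: etrans (row_mxEl _ _ _ _) _; rewrite mxE eqxx mulr1n.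
Qed.

Lemma rV_consES p i : rV_cons p 0 (lift ord0 i) = p.2 0 i.
Proof.
rewrite (_ : lift ord0 i = @rshift 1 n i); last exact/val_inj.
exact: row_mxEr.
Qed.

Lemma rV_consK : cancel rV_cons rV_uncons.
Proof.
move=> [x v]; congr pair; first exact: rV_consE0.
by apply/rowP => i; rewrite mxE rV_consES.
Qed.

Lemma rV_unconsK : cancel rV_uncons rV_cons.
Proof.
move=> v; apply/rowP => i; case: (unliftP ord0 i) => [j|] ->.
  by rewrite rV_consES mxE.
by rewrite rV_consE0.
Qed.

Lemma measurable_rV_cons : measurable_fun setT rV_cons.
Proof.
apply: measurable_rV => i; case: (unliftP ord0 i) => [j|] ->.
  under eq_fun do rewrite rV_consES.
  exact: (measurableT_comp (measurable_fun_coord j)).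
under eq_fun do rewrite rV_consE0.
exact: measurable_fst.
Qed.

Lemma measurable_rV_uncons : measurable_fun setT rV_uncons.
Proof.
apply/measurable_fun_pairP; split.
  exact: measurable_fun_coord.
apply: measurable_rV => i.
under eq_fun do rewrite mxE.
exact: measurable_fun_coord.
Qed.

Context (mu : {sigma_finite_measure set 'rV[R]_n -> \bar R}).

Definition lebesgue_rV_step : set 'rV[R]_n.+1 -> \bar R :=
  pushforward (lebesgue_measure \x mu)%E rV_cons.

Let lebesgue_rV_step0 : lebesgue_rV_step set0 = 0%E.
Proof. by rewrite /lebesgue_rV_step /pushforward preimage_set0 measure0. Qed.

Let lebesgue_rV_step_ge0 A : (0 <= lebesgue_rV_step A)%E.
Proof. by rewrite /lebesgue_rV_step /pushforward measure_ge0. Qed.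

Let lebesgue_rV_step_sigma_additive : semi_sigma_additive lebesgue_rV_step.
Proof.
have mpre A : measurable A -> measurable (rV_cons @^-1` A).
  by move=> mA; rewrite -[X in measurable X]setTI; exact: measurable_rV_cons.
move=> F mF tF mUF; rewrite /lebesgue_rV_step /pushforward preimage_bigcup.
apply: measure_semi_sigma_additive; first by move=> k; exact: mpre.
- apply/trivIsetP => /= i j _ _ ij; rewrite -preimage_setI.
  by move/trivIsetP : tF => /(_ _ _ _ _ ij) ->//; rewrite preimage_set0.
- by rewrite -preimage_bigcup; exact: mpre.
Qed.

HB.instance Definition _ := isMeasure.Build _ _ _ lebesgue_rV_step
  lebesgue_rV_step0 lebesgue_rV_step_ge0 lebesgue_rV_step_sigma_additive.

Let lebesgue_rV_step_sigma_finite : sigma_finite setT lebesgue_rV_step.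
Proof.
have /sigma_finiteP[F [FT ndF Foo]] := sigma_finiteT (@lebesgue_measure R).
have /sigma_finiteP[G [GT ndG Goo]] := sigma_finiteT mu.
exists (fun k => rV_uncons @^-1` (F k `*` G k)).
  apply/esym/seteqP; split=> // v _.
  have [i _ Fi] : (\bigcup_k F k) (rV_uncons v).1 by rewrite -FT.
  have [j _ Gj] : (\bigcup_k G k) (rV_uncons v).2 by rewrite -GT.
  exists (maxn i j) => //; split.
    by apply: (subsetPset _ _ (ndF _ _ (leq_maxl i j))).
  by apply: (subsetPset _ _ (ndG _ _ (leq_maxr i j))).
move=> k; have [mF Fk] := Foo k; have [mG Gk] := Goo k.
have mFG : measurable (F k `*` G k) by exact: measurableX.
split; first by rewrite -[X in measurable X]setTI; exact: measurable_rV_uncons.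
rewrite /lebesgue_rV_step /pushforward -comp_preimage.
rewrite (_ : _ \o _ = id); last by apply/funext; exact: rV_consK.
by rewrite preimage_id product_measure1E// lte_mul_pinfty// ge0_fin_numE.
Qed.

HB.instance Definition _ := Measure_isSigmaFinite.Build _ _ _ lebesgue_rV_step
  lebesgue_rV_step_sigma_finite.

End lebesgue_rV_step.

(* n-fold product of the one-dimensional Lebesgue measure, cf. lebesgue_rV_box;
   for n = 0, unit mass at the only point. *)
Fixpoint lebesgue_rV (R : realType) (n : nat) :
    {sigma_finite_measure set 'rV[R]_n -> \bar R} :=
  if n is n'.+1 then lebesgue_rV_step (lebesgue_rV R n')
  else \d_(0 : 'rV[R]_0).

Lemma lebesgue_rV_box (R : realType) (n : nat) (A : 'I_n -> set R) :
  (forall i, measurable (A i)) ->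
  lebesgue_rV R n [set v | forall i, A i (v 0 i)] =
  (\prod_(i < n) lebesgue_measure (A i))%E.
Proof.
elim: n A => [|n IHn] A mA.
  by rewrite big_ord0 /= diracE mem_set//= => -[].
have mB : measurable [set v : 'rV[R]_n | forall i, A (lift ord0 i) (v 0 i)].
  rewrite [X in measurable X](_ : _ = \bigcap_(i in [set: 'I_n])
     ((fun v : 'rV[R]_n => v 0 i) @^-1` A (lift ord0 i))).
    apply: fin_bigcap_measurable => // i _.
    by rewrite -[X in measurable X]setTI; exact: measurable_fun_coord.
  by apply/seteqP; split => v /= h i *; exact: h.
rewrite big_ord_recl -IHn//.
have mA0 : @measurable _ (measurableTypeR R) (A ord0) by exact: mA.
rewrite -(product_measure1E lebesgue_measure (lebesgue_rV R n) mA0 mB).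
rewrite /= /lebesgue_rV_step /pushforward; congr (_ _).
apply/seteqP; split => -[x v] /=.
  move=> h; split; first by have := h 0; rewrite rV_consE0.
  by move=> i; have := h (lift ord0 i); rewrite rV_consES.
move=> [h0 h] i; case: (unliftP ord0 i) => [j|] ->.
  by rewrite rV_consES; exact: h.
by rewrite rV_consE0.
Qed.

Section p_harmonious.
Context (R : realType) (n : nat).
Implicit Types (Omega : set 'rV[R]_n) (eps : R).

(* The norm `|x| and the balls of the library on 'rV[R]_n are those of the
   sup norm; the topology is the same as that of the Euclidean norm. *)
Definition enorm (x : 'rV[R]_n) : R := Num.sqrt (\sum_(i < n) x 0 i ^+ 2).

Definition eball (x : 'rV[R]_n) eps : set 'rV[R]_n :=
  [set y | enorm (y - x) < eps].

(* Meaningful for nonempty A only: inf set0 = 0. *)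
Definition edist_set (x : 'rV[R]_n) (A : set 'rV[R]_n) : R :=
  inf [set enorm (x - y) | y in A].

Definition strip Omega eps : set 'rV[R]_n :=
  [set x | ~ Omega x /\ edist_set x Omega <= eps].

Definition thickening Omega eps : set 'rV[R]_n := strip Omega eps `|` Omega.

(* Functions on the strip and on the thickening are total functions whose
   values outside these sets are irrelevant. For open Omega, both sets are Borel
   (the thickening is closed), so that measurable_fun, which presupposes a
   measurable domain, is not vacuous. The integral over the ball is the
   real-valued Rintegral. *)
Record p_harmonious (alpha beta eps : R) Omega (g u : 'rV[R]_n -> R) : Prop := {
  bdry_bounded : [bounded g x | x in strip Omega eps] ;
  bdry_borel : measurable_fun (strip Omega eps) g ;
  harm_bounded : [bounded u x | x in thickening Omega eps] ;
  harm_borel : measurable_fun (thickening Omega eps) u ;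
  harm_bdry : forall x, strip Omega eps x -> u x = g x ;
  harm_dpp : forall x, Omega x ->
    u x = alpha / 2 * sup [set u y | y in eball x eps]
        + alpha / 2 * inf [set u y | y in eball x eps]
        + beta / fine (lebesgue_rV R n (eball x eps))
          * \int[lebesgue_rV R n]_(y in eball x eps) u y
}.

End p_harmonious.

(* Main.v *)
Require Import Defs.
From mathcomp Require Import all_boot all_order all_algebra.
From mathcomp Require Import all_classical all_reals all_analysis.
From mathcomp Require Import ring lra.

Set Implicit Arguments.
Unset Strict Implicit.
Unset Printing Implicit Defensive.
Import Order.TTheory GRing.Theory Num.Theory.
Import numFieldNormedType.Exports.

Local Open Scope classical_set_scope.
Local Open Scope ring_scope.

(** Write [d = |u' - u|], [M] for the supremum of [d] over [Omega] and [m] for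
    its supremum over the boundary strip, and suppose [m < M], so that [d <= M]
    on the whole thickening. Suprema and infima over a ball are 1-Lipschitz for
    the sup distance, so subtracting the two dynamic programming principles
    bounds [d x] by [alpha * M] plus [beta] times the average of [d] over the
    ball at [x] (p_harmonious_dist_le). As [beta > 0], the average propagates
    any gain: if [d <= M - c] on a part of the ball that occupies a proportion
    at least [theta] of it, then [d x <= M - beta * theta * c].

    Such a gain comes in from one side. Every ball of radius [eps] contains,
    ahead of its centre in the first coordinate, a cube whose points all have
    first coordinate at least [x_0 + delta], and which occupies at least a
    proportion [theta > 0] of the ball, where [delta] and [theta] do not depend
    on the centre (eball_forward_cube). Points of the thickening with [x_0 >= K],
    where [K] bounds [Omega], lie in the strip, and there [d <= m = M - (M - m)].
    Induction on [k] then gives [d <= M - c_k] with [c_k > 0] wherever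
    [x_0 >= K - k delta]. Since [Omega] is bounded, finitely many layers cover
    it, and [d <= M - c_k] on [Omega] contradicts the choice of [M]. *)

(** * Suprema, infima and integrals of nearby functions *)

Section sup_dist.
Context (R : realType) (T : Type).
Implicit Types (u v : T -> R) (B : set T).

Lemma bounded_imageP u B : [bounded u x | x in B] <->
  exists M, forall x, B x -> `|u x| <= M.
Proof.
split=> [/ex_strict_bound_gt0[M _ uM]|[M uM]]; first by exists M => x /uM /ltW.
exists M; split; first exact: num_real.
by move=> N MN x /uM uxM; exact: le_trans uxM (ltW MN).
Qed.

Lemma bounded_imageN u B :
  [bounded u x | x in B] -> [bounded - u x | x in B].
Proof.
move=> /bounded_imageP[M uM]; apply/bounded_imageP; exists M => x /uM.
by rewrite normrN.
Qed.

Lemma bounded_image_has_ubound u B :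
  [bounded u x | x in B] -> has_ubound [set u y | y in B].
Proof.
move=> /bounded_imageP[M uM]; exists M => _ [y /uM uyM <-].
exact: le_trans (ler_norm _) uyM.
Qed.

Lemma le_sup_image u v B S : B !=set0 ->
    [bounded v x | x in B] -> (forall y, B y -> u y <= v y + S) ->
  sup [set u y | y in B] <= sup [set v y | y in B] + S.
Proof.
move=> [b Bb] bv uvS; apply: ge_sup; first by exists (u b), b.
move=> _ [y By <-]; apply: le_trans (uvS _ By) _; rewrite lerD2r.
by apply: ub_le_sup; [exact: bounded_image_has_ubound|exists y].
Qed.

Lemma dist_sup_image_le u v B S : B !=set0 ->
    [bounded u x | x in B] -> [bounded v x | x in B] ->
    (forall y, B y -> `|u y - v y| <= S) ->
  `|sup [set u y | y in B] - sup [set v y | y in B]| <= S.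
Proof.
move=> B0 bu bv uvS; have uv : forall y, B y -> u y <= v y + S.
  by move=> y /uvS; rewrite ler_norml; lra.
have vu : forall y, B y -> v y <= u y + S.
  by move=> y /uvS; rewrite ler_norml; lra.
have := le_sup_image B0 bv uv; have := le_sup_image B0 bu vu.
rewrite ler_norml; lra.
Qed.

Lemma dist_inf_image_le u v B S : B !=set0 ->
    [bounded u x | x in B] -> [bounded v x | x in B] ->
    (forall y, B y -> `|u y - v y| <= S) ->
  `|inf [set u y | y in B] - inf [set v y | y in B]| <= S.
Proof.
move=> B0 bu bv uvS; rewrite /inf !image_comp -opprD normrN.
apply: dist_sup_image_le => //.
- exact: bounded_imageN.
- exact: bounded_imageN.
- by move=> y /uvS; rewrite /= -opprD normrN.
Qed.

End sup_dist.

(** The bound for the average in the contraction estimate: the constant [S]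
    integrates to [S * mu A], and the better bound [s] on [E] saves
    [(S - s) * mu E]. *)
Lemma Rintegral_le_two_levels (R : realType) (d : measure_display)
    (T : measurableType d) (mu : {measure set T -> \bar R}) (A E : set T)
    (f : T -> R) (S s : R) :
    measurable A -> (mu A < +oo)%E -> measurable E -> E `<=` A ->
    mu.-integrable A (EFin \o f) ->
    (forall x, A x -> f x <= S) -> (forall x, E x -> f x <= s) ->
  \int[mu]_(x in A) f x <= S * fine (mu A) - (S - s) * fine (mu E).
Proof.
move=> mA Aoo mE EA intf fS fs.
have mAE : measurable (A `\` E) by exact: measurableD.
have Eoo : (mu E < +oo)%E.
  by apply: le_lt_trans Aoo; rewrite le_measure ?inE.
have AEoo : (mu (A `\` E) < +oo)%E.
  by apply: le_lt_trans Aoo; rewrite le_measure ?inE//; exact: subDsetl.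
have AE : E `|` (A `\` E) = A by rewrite setDUK.
have EAE : [disjoint E & A `\` E] by rewrite disj_set2E setDIK.
have muA : fine (mu A) = fine (mu E) + fine (mu (A `\` E)).
  rewrite -fineD ?ge0_fin_numE// -measureU ?AE//.
  by apply/eqP; rewrite -disj_set2E.
rewrite -AE Rintegral_setU ?AE// muA.
have int_le D r : measurable D -> D `<=` A -> (mu D < +oo)%E ->
    (forall x, D x -> f x <= r) -> \int[mu]_(x in D) f x <= r * fine (mu D).
  move=> mD DA Doo fr; rewrite -Rintegral_cst//; apply: le_Rintegral => //.
    exact: integrableS intf.
  apply: measurable_bounded_integrable => //.
  by apply/bounded_imageP; exists `|r|.
have := int_le E s mE EA Eoo fs.
have := int_le (A `\` E) S mAE (@subDsetl _ _ _) AEoo (fun x Dx => fS x Dx.1).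
lra.
Qed.

(** * Euclidean balls *)

Section euclidean_ball.
Context (R : realType) (n : nat).
Implicit Types (x y : 'rV[R]_n) (eps : R) (Omega : set 'rV[R]_n).

Lemma enorm0 : enorm (0 : 'rV[R]_n) = 0.
Proof. by rewrite /enorm big1 ?sqrtr0// => i _; rewrite mxE expr0n. Qed.

Lemma ler_coord_enorm x i : `|x 0 i| <= enorm x.
Proof.
rewrite -sqrtr_sqr ler_wsqrtr// (bigD1 i)//= lerDl.
by apply: sumr_ge0 => j _; rewrite sqr_ge0.
Qed.

Lemma eball_center x eps : 0 < eps -> eball x eps x.
Proof. by move=> e0; rewrite /eball /= subrr enorm0. Qed.

Lemma eball_open x eps : open (eball x eps).
Proof.
rewrite (_ : eball x eps = (fun y => Num.sqrt (\sum_(i < n)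
    (y 0 i - x 0 i) ^+ 2)) @^-1` [set r | r < eps]); last first.
  apply/funext => y; rewrite /eball/= /enorm.
  by congr (is_true (Num.sqrt _ < _)); apply: eq_bigr => i _; rewrite !mxE.
apply: open_comp; last exact: open_lt.
move=> y _.
apply: (@continuous_comp _ _ _
  (fun z : 'rV[R]_n => \sum_(i < n) (z 0 i - x 0 i) ^+ 2) Num.sqrt); last first.
  exact: sqrt_continuous.
move: y; apply: (@continuous_big R 'I_n +%R 0 predT _ 'rV[R]_n _
  (fun i (z : 'rV[R]_n) => (z 0 i - x 0 i) ^+ 2)).
  exact: (@add_continuous R).
move=> i _ y; rewrite /continuous_at.
have c0 : {for y, continuous (fun z : 'rV[R]_n => z 0 i)}.
  exact: coord_continuous.
have c : {for y, continuous (fun z : 'rV[R]_n => z 0 i - x 0 i)}.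
  exact: (cvgB c0 (cvg_cst (x 0 i))).
exact: (cvgM c c).
Qed.

Lemma measurable_eball x eps : measurable (eball x eps).
Proof. by apply: open_measurable_rV; exact: eball_open. Qed.

Lemma edist_set_le x y Omega : Omega y -> edist_set x Omega <= enorm (x - y).
Proof.
move=> Oy; apply: ge_inf; last by exists y.
by exists 0 => _ [z _ <-]; exact: sqrtr_ge0.
Qed.

Lemma eball_sub_thickening Omega eps x :
  Omega x -> eball x eps `<=` thickening Omega eps.
Proof.
move=> Ox y xy; have [Oy|nOy] := pselect (Omega y); [by right|left; split=> //].
exact: le_trans (edist_set_le _ Ox) (ltW xy).
Qed.

(** This allows measurability to be restricted from the thickening to the balls
    inside it. For positive [eps] the thickening is the countable intersection of
    the open neighbourhoods of [Omega] of radii [eps + 1 / k.+1]. *)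
Lemma measurable_thickening Omega eps : Omega !=set0 -> 0 < eps ->
  measurable (thickening Omega eps).
Proof.
move=> [z Oz] e0.
rewrite (_ : thickening Omega eps =
    \bigcap_k \bigcup_(y in Omega) eball y (eps + k.+1%:R^-1)).
  apply: bigcapT_measurable => k; apply: open_measurable_rV.
  by apply: bigcup_open => y _; exact: eball_open.
apply/seteqP; split=> [x [[_ xe]|Ox] k _|x xO].
- have /inf_lt[|_ [y Oy <-] xy] : edist_set x Omega < eps + k.+1%:R^-1.
    by rewrite (le_lt_trans xe)// ltrDl invr_gt0.
    by exists (enorm (x - z)), z.
  by exists y.
- by exists x => //; apply: eball_center; rewrite addr_gt0// invr_gt0.
- have [Ox|nOx] := pselect (Omega x); [by right|left; split=> //].
  apply/ler_addgt0Pr => e e_gt0.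
  have [k _ /(_ k (leqnn k)) /= ke] := near_infty_natSinv_lt (PosNum e_gt0).
  have [y Oy /ltW xy] := xO k I.
  by rewrite (le_trans (edist_set_le x Oy))// (le_trans xy)// lerD2l ltW.
Qed.

Definition open_box (a b : 'I_n -> R) : set 'rV[R]_n :=
  [set y | forall i, y 0 i \in `]a i, b i[].

Lemma measurable_open_box a b : measurable (open_box a b).
Proof.
rewrite (_ : open_box a b =
    \bigcap_(i in [set: 'I_n]) ((fun v : 'rV[R]_n => v 0 i) @^-1`
       [set` `]a i, b i[])).
  apply: fin_bigcap_measurable => // i _.
  by rewrite -[X in measurable X]setTI; exact: measurable_fun_coord.
by apply/seteqP; split => v /= h i *; exact: h.
Qed.

Lemma lebesgue_cube a r : 0 < r ->
  lebesgue_rV R n (open_box a (fun i => a i + r)) = (r ^+ n)%:E.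
Proof.
move=> r0; rewrite (lebesgue_rV_box (A := fun i => [set` `]a i, a i + r[])).
  2: by move=> i; exact: measurable_itv.
rewrite (eq_bigr (fun=> r%:E)) => [|i _]; first last.
  rewrite lebesgue_measure_itv /= lte_fin ltrDl r0.
  by rewrite -EFinD (addrC (a i)) addrK.
by rewrite prodEFin prodr_const card_ord.
Qed.

Lemma eball_sub_cube x eps :
  eball x eps `<=`
    open_box (fun i => x 0 i - eps) (fun i => x 0 i - eps + eps *+ 2).
Proof.
move=> y xy i; have := le_lt_trans (ler_coord_enorm (y - x) i) xy.
by rewrite !mxE ltr_norml /= in_itv/= mulr2n; lra.
Qed.

Lemma lebesgue_eball_lty x eps :
  0 < eps -> (lebesgue_rV R n (eball x eps) < +oo)%E.
Proof.
move=> e0; have e20 : 0 < eps *+ 2 by rewrite pmulrn_lgt0.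
have cubey := lebesgue_cube (fun i => x 0 i - eps) e20.
apply: le_lt_trans (ltry ((eps *+ 2) ^+ n)); rewrite -cubey.
rewrite le_measure ?inE//; last exact: eball_sub_cube.
- exact: measurable_eball.
- exact: measurable_open_box.
Qed.

(** This is what makes the gain uniform in the centre: the volume of the cube
    is explicit, and the ball lies in a cube of side [2 * eps], so the ratio is
    controlled without computing the volume of the ball. *)
Lemma eball_forward_cube eps : 0 < eps ->
  exists2 delta, 0 < delta & exists2 theta, 0 < theta & forall x, exists E,
    [/\ measurable E, E `<=` eball x eps,
        (forall y i, E y -> x 0 i + delta <= y 0 i) &
        theta <=
          fine (lebesgue_rV R n E) / fine (lebesgue_rV R n (eball x eps))].
Proof.
move=> e0.
(* The cube has coordinates between [delta] and [2 * delta] ahead of the centre,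
   so its points are at squared distance at most [n * (eps / n.+1) ^+ 2]. *)
set delta := eps / 2 / n.+1%:R.
have d0 : 0 < delta by rewrite !divr_gt0.
have e20 : 0 < eps *+ 2 by rewrite pmulrn_lgt0.
exists delta => //; exists ((delta / (eps *+ 2)) ^+ n).
  by rewrite exprn_gt0// divr_gt0.
move=> x.
pose E := open_box (fun i => x 0 i + delta) (fun i => x 0 i + delta + delta).
have mE : measurable E by exact: measurable_open_box.
have EB : E `<=` eball x eps.
  move=> y Ey; rewrite /eball/= /enorm.
  have -> : eps = Num.sqrt (eps ^+ 2) by rewrite sqrtr_sqr gtr0_norm.
  rewrite ltr_sqrt ?exprn_gt0//.
  apply: (@le_lt_trans _ _ (\sum_(i < n) (eps / n.+1%:R) ^+ 2)).
    apply: ler_sum => i _; have := Ey i; rewrite /= in_itv/= => /andP[].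
    have -> : eps / n.+1%:R = delta + delta by rewrite /delta; field.
    rewrite !mxE => h1 h2; rewrite ler_sqr ?nnegrE; lra.
  rewrite sumr_const card_ord expr_div_n -[ltLHS]mulr_natl mulrCA.
  rewrite gtr_pMr ?exprn_gt0//.
  rewrite ltr_pdivrMr ?exprn_gt0// mul1r expr2 -natrM ltr_nat.
  by rewrite mulnS ltnS leq_addr.
exists E; split=> //.
  by move=> y i /(_ i); rewrite /= in_itv/= => /andP[/ltW].
have mB := measurable_eball x eps.
have Boo := lebesgue_eball_lty x e0.
have muE : fine (lebesgue_rV R n E) = delta ^+ n by rewrite lebesgue_cube.
have muB : fine (lebesgue_rV R n (eball x eps)) <= (eps *+ 2) ^+ n.
  rewrite -lee_fin fineK ?ge0_fin_numE//.
  rewrite -(lebesgue_cube (fun i => x 0 i - eps) e20).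
  rewrite le_measure ?inE//; [exact: measurable_open_box|exact: eball_sub_cube].
(* Positivity of the volume of the ball, needed to compare inverses, comes from
   the cube inside it. *)
have EleB : delta ^+ n <= fine (lebesgue_rV R n (eball x eps)).
  rewrite -muE fine_le ?ge0_fin_numE// ?le_measure ?inE//.
  by apply: le_lt_trans Boo; rewrite le_measure ?inE.
have muB0 := lt_le_trans (exprn_gt0 n d0) EleB.
by rewrite muE expr_div_n ler_pM2l ?exprn_gt0// lef_pV2 ?posrE// exprn_gt0.
Qed.

End euclidean_ball.

(** * The contraction estimate and the comparison theorem *)

Section comparison.
Context (R : realType) (n : nat) (alpha beta eps : R) (Omega : set 'rV[R]_n).

Lemma p_harmonious_integrable g u x :
  0 < eps -> p_harmonious alpha beta eps Omega g u -> Omega x ->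
  (lebesgue_rV R n).-integrable (eball x eps) (EFin \o u).
Proof.
move=> eps_gt0 hu Ox; have BT := eball_sub_thickening (eps := eps) Ox.
apply: measurable_bounded_integrable.
- exact: measurable_eball.
- exact: lebesgue_eball_lty.
- apply: measurable_funS BT (harm_borel hu).
  by apply: measurable_thickening => //; exists x.
- have /bounded_imageP[M uM] := harm_bounded hu.
  by apply/bounded_imageP; exists M => y /BT /uM.
Qed.

(** By the dynamic programming principle, [u' x - u x] combines the differences
    of the suprema, of the infima and of the averages with weights [alpha / 2],
    [alpha / 2] and [beta]. The first two are at most [S]; the averaged term
    alone sees the smaller bound [s] on [E], and gains from it in proportion to
    the volume of [E]. *)
Lemma p_harmonious_dist_le g g' u u' S s x E :
    0 < eps -> 0 <= alpha -> 0 <= beta ->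
    p_harmonious alpha beta eps Omega g u ->
    p_harmonious alpha beta eps Omega g' u' ->
    Omega x -> measurable E -> E `<=` eball x eps ->
    0 < fine (lebesgue_rV R n (eball x eps)) ->
    (forall y, eball x eps y -> `|u' y - u y| <= S) ->
    (forall y, E y -> `|u' y - u y| <= s) ->
  `|u' x - u x| <= alpha * S + beta * (S - (S - s) *
    (fine (lebesgue_rV R n E) / fine (lebesgue_rV R n (eball x eps)))).
Proof.
move=> eps_gt0 alpha_ge0 beta_ge0 hu hu' Ox mE EB muB0 dS ds.
have BT := eball_sub_thickening (eps := eps) Ox.
have B0 : eball x eps !=set0 by exists x; exact: eball_center.
have bndB v f : p_harmonious alpha beta eps Omega f v ->
    [bounded v y | y in eball x eps].
  move=> /harm_bounded/bounded_imageP[M vM].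
  by apply/bounded_imageP; exists M => y /BT /vM.
have mB := measurable_eball x eps.
have Boo := lebesgue_eball_lty x eps_gt0.
have iu := p_harmonious_integrable eps_gt0 hu Ox.
have iu' := p_harmonious_integrable eps_gt0 hu' Ox.
have iB : (lebesgue_rV R n).-integrable (eball x eps)
    (EFin \o (fun y => u' y - u y)).
  by apply: eq_integrable (integrableB mB iu' iu).
have iaB : (lebesgue_rV R n).-integrable (eball x eps)
    (EFin \o (fun y => `|u' y - u y|)).
  by apply: eq_integrable (integrable_abse iB).
have dsup := dist_sup_image_le B0 (bndB _ _ hu') (bndB _ _ hu) dS.
have dinf := dist_inf_image_le B0 (bndB _ _ hu') (bndB _ _ hu) dS.
have dint := le_trans (le_normr_Rintegral mB iB)
  (Rintegral_le_two_levels mB Boo mE EB iaB dS ds).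
rewrite RintegralB// in dint.
rewrite (harm_dpp hu Ox) (harm_dpp hu' Ox).
move: muB0 dsup dinf dint.
set b := fine _; set e := fine _; set I' := \int[_]_(_ in _) u' _.
set I := \int[_]_(_ in _) u _.
set p' := sup _; set p := sup _; set q' := inf _; set q := inf _.
move=> b0 dp dq dI.
have -> : alpha / 2 * p' + alpha / 2 * q' + beta / b * I' -
    (alpha / 2 * p + alpha / 2 * q + beta / b * I) =
    alpha / 2 * (p' - p) + alpha / 2 * (q' - q) + beta / b * (I' - I) by ring.
have a2 : 0 <= alpha / 2 by rewrite divr_ge0.
have bb : 0 <= beta / b by rewrite divr_ge0// ltW.
apply: le_trans (ler_normD _ _) _.
apply: le_trans (lerD (ler_normD _ _) (lexx _)) _.
rewrite !(normrM (alpha / 2)) (normrM (beta / b)).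
rewrite !(ger0_norm a2) (ger0_norm bb).
have -> : alpha * S + beta * (S - (S - s) * (e / b)) =
    alpha / 2 * S + alpha / 2 * S + beta / b * (S * b - (S - s) * e).
  by field; rewrite gt_eqF.
by rewrite !lerD// ler_wpM2l.
Qed.

End comparison.

Theorem theorem2p2 (R : realType) (n : nat) (n_gt0 : (0 < n)%N)
    (Omega : set 'rV[R]_n) (Omega_open : open Omega)
    (Omega_connected : connected Omega) (Omega_nonempty : Omega !=set0)
    (Omega_bounded : bounded_set Omega)
    (eps alpha beta : R) (eps_gt0 : 0 < eps)
    (alpha_gt0 : 0 < alpha) (beta_gt0 : 0 < beta)
    (alpha_beta : alpha + beta = 1)
    (g g' u u' : 'rV[R]_n -> R)
    (u_harm : p_harmonious alpha beta eps Omega g u)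
    (u'_harm : p_harmonious alpha beta eps Omega g' u') :
  sup [set `|u' x - u x| | x in Omega] <=
  sup [set `|g' x - g x| | x in strip Omega eps].
Proof.
pose d x := `|u' x - u x|.
have bnd_dist (v v' : 'rV[R]_n -> R) A : [bounded v x | x in A] ->
    [bounded v' x | x in A] -> has_ubound [set `|v' x - v x| | x in A].
  move=> /bounded_imageP[M vM] /bounded_imageP[M' vM'].
  exists (M' + M) => _ [x Ax <-].
  by rewrite (le_trans (ler_normB _ _))// lerD ?vM ?vM'.
set M := sup _; set m := sup _; rewrite leNgt; apply/negP => mM.
have dm x : strip Omega eps x -> d x <= m.
  move=> sx; rewrite /d (harm_bdry u_harm sx) (harm_bdry u'_harm sx).
  apply: ub_le_sup; last by exists x.
  exact: bnd_dist (bdry_bounded u_harm) (bdry_bounded u'_harm).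
have dM x : thickening Omega eps x -> d x <= M.
  move=> [/dm dxm|Ox]; first exact: le_trans dxm (ltW mM).
  apply: ub_le_sup; last by exists x.
  have [N dN] := bnd_dist _ _ _ (harm_bounded u_harm) (harm_bounded u'_harm).
  by exists N => _ [y Oy <-]; apply: dN; exists y => //; right.
pose i0 := Ordinal n_gt0.
have [K K0 OK] : exists2 K, 0 < K & forall x, Omega x -> `|x 0 i0| < K.
  have [K K0 OK] := ex_strict_bound_gt0 Omega_bounded.
  exists K => // x /OK /=; apply: le_lt_trans.
  rewrite [leRHS]/Num.norm/= mx_normrE.
  exact: (le_bigmax _ (fun i : 'I_1 * 'I_n => `|x i.1 i.2|) (0, i0)).
have [delta d0 [theta t0 cubes]] := eball_forward_cube n eps_gt0.
have layer k : exists2 c, 0 < c <= M - m & forall x, thickening Omega eps x ->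
    K - k%:R * delta <= x 0 i0 -> d x <= M - c.
  elim: k => [|k [c /andP[c0 cMm] IHk]].
    exists (M - m); first by rewrite lexx subr_gt0 mM.
    move=> x [/dm dxm _|/OK]; first by rewrite subKr.
    by rewrite ltr_norml mul0r subr0 leNgt => /andP[_ ->].
  (* The minimum keeps the gain below [M - m], so that points of the strip
     satisfy the same bound. *)
  exists (Num.min c (beta * theta * c)).
    by rewrite lt_min c0 !mulr_gt0//= ge_min cMm.
  move=> x [/dm dxm _|Ox xk].
    apply: le_trans dxm _; rewrite lerBrDr -lerBrDl ge_min; apply/orP; left.
    exact: cMm.
  have [E [mE EB Ex thetaE]] := cubes x.
  (* Inverting zero gives zero, so a null ball would contradict [theta > 0]. *)
  have B0 : 0 < fine (lebesgue_rV R n (eball x eps)).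
    rewrite lt_neqAle fine_ge0// andbT; apply/negP => /eqP B0.
    by move: thetaE; rewrite -B0 invr0 mulr0 leNgt t0.
  have BT := eball_sub_thickening (eps := eps) Ox.
  have dE y : E y -> d y <= M - c.
    move=> Ey; apply: IHk; first exact/BT/EB.
    by apply: le_trans (Ex y i0 Ey); move: xk; rewrite -natr1; lra.
  apply: le_trans (p_harmonious_dist_le eps_gt0 (ltW alpha_gt0) (ltW beta_gt0)
    u_harm u'_harm Ox mE EB B0
    (fun y By => dM y (BT y By)) dE) _.
  rewrite subKr.
  apply: (@le_trans _ _ (M - beta * theta * c)); last first.
    by rewrite lerB// ge_min lexx orbT.
  rewrite mulrBr addrA -mulrDl alpha_beta mul1r lerB//.
  rewrite -mulrA ler_wpM2l ?(ltW beta_gt0)//.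
  by rewrite mulrC ler_wpM2l// ltW.
(* On [Omega] the first coordinate exceeds [- K], hence a layer starting at or
   below [- K] contains all of [Omega]. *)
have [k kK] : exists k : nat, K + K <= k%:R * delta.
  exists (Num.bound ((K + K) / delta)).
  rewrite -ler_pdivrMr// ltW// archi_boundP// divr_ge0// ?ltW// addr_gt0//.
have [c /andP[c0 _] dc] := layer k.
suff : M <= M - c by rewrite leNgt gtrBl c0.
apply: ge_sup; first by have [z Oz] := Omega_nonempty; exists (d z), z.
move=> _ [x Ox <-]; apply: dc; first by right.
by have := OK x Ox; rewrite ltr_norml => /andP[]; lra.
Qed.
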